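(* Let $ABC$ be a nondegenerate triangle with incenter $I$, circumcenter $O$ and orthocenter $H$. For every real $\lambda$, $$\mathrm{ELD}_I(\lambda)\ \ge\ d_I\ \ge\ 0 .$$
   Context: For real $\lambda$, $\mathrm{ELD}_I(\lambda)=|XI|^2$, where $X=(1-\lambda)H+\lambda O$ (the affine combination of $H$ and $O$) is a point on the Euler line. $d_I$ denotes the minimum value of $\mathrm{ELD}_I(\lambda)$ over $\lambda\in\mathbb{R}$, i.e. the squared distance from $I$ to the Euler line. With $s$ the semiperimeter, $r$ the inradius and $R$ the circumradius, when the triangle is not equilateral (so that $|OH|^2=9R^2+8Rr+2r^2-2s^2\neq 0$) it is given by $$d_I=-\frac{s^4-2(2R^2+10Rr-r^2)s^2+r(4R+r)^3}{4(9R^2+8Rr+2r^2-2s^2)}.$$ In the equilateral case $H=O=I$, and $d_I=0$. *)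

(* Defs.v *)
From Stdlib Require Import Reals.
From Coquelicot Require Import Coquelicot.
Open Scope R_scope.

Definition point : Type := (R * R)%type.

Definition pdist (P Q : point) : R :=
  dist_euc (fst P) (snd P) (fst Q) (snd Q).

Definition dot (P Q P' Q' : point) : R :=
  (fst Q - fst P) * (fst Q' - fst P') + (snd Q - snd P) * (snd Q' - snd P').

(* Twice the signed area of the triangle P Q T. *)
Definition area2 (P Q T : point) : R :=
  (fst Q - fst P) * (snd T - snd P) - (snd Q - snd P) * (fst T - fst P).

Definition nondegenerate (A B C : point) : Prop := area2 A B C <> 0.

Definition equilateral (A B C : point) : Prop :=
  pdist A B = pdist B C /\ pdist B C = pdist C A.

Definition semiperimeter (A B C : point) : R :=
  (pdist B C + pdist C A + pdist A B) / 2.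

(* Distance from T to the line P Q; meaningful only for P <> Q. *)
Definition dist_line (T P Q : point) : R := Rabs (area2 P Q T) / pdist P Q.

Definition in_interior (A B C P : point) : Prop :=
  exists u v w : R, 0 < u /\ 0 < v /\ 0 < w /\ u + v + w = 1 /\
    P = (u * fst A + v * fst B + w * fst C,
         u * snd A + v * snd B + w * snd C).

(* I is the incenter and r the inradius. Being interior is what excludes
   the three excenters, which are also equidistant from the side lines. *)
Definition is_incircle (A B C I : point) (r : R) : Prop :=
  in_interior A B C I /\
  dist_line I B C = r /\ dist_line I C A = r /\ dist_line I A B = r.

(* O is the circumcenter and Rc the circumradius. *)
Definition is_circumcircle (A B C O : point) (Rc : R) : Prop :=
  pdist O A = Rc /\ pdist O B = Rc /\ pdist O C = Rc.

Definition is_orthocenter (A B C H : point) : Prop :=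
  dot A H B C = 0 /\ dot B H C A = 0 /\ dot C H A B = 0.

Definition euler_point (H O : point) (lambda : R) : point :=
  ((1 - lambda) * fst H + lambda * fst O,
   (1 - lambda) * snd H + lambda * snd O).

Definition ELD (I H O : point) (lambda : R) : R :=
  (pdist (euler_point H O lambda) I) ^ 2.

(* Minimum over lambda, taken as a greatest lower bound so as to be total;
   the finite part is harmless because the values are bounded below by 0. *)
Definition min_ELD (I H O : point) : R :=
  real (Glb_Rbar (fun y => exists lambda : R, y = ELD I H O lambda)).

(* Main.v *)
(* With the circumcenter as origin, H = A + B + C and
   I = (a A + b B + c C) / (a + b + c), and B.C = R^2 - a^2/2 etc.  Hence OH^2,
   OI^2 and HI^2 are functions of the side lengths; the relations abc = 4Rrs and
   ab + bc + ca = s^2 + r^2 + 4Rr turn them into polynomials in s, r, R.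
   Finally ELD is a quadratic function of lambda whose coefficients are
   combinations of these three squares, so its minimum is explicit. *)
Require Import Defs.
From Stdlib Require Import Reals Lra.
From Coquelicot Require Import Coquelicot.
Open Scope R_scope.

(** * Distances and areas in coordinates *)

Lemma pdist_nonneg (P Q : point) : 0 <= pdist P Q.
Proof. apply sqrt_pos. Qed.

Lemma pdist_sqr (P Q : point) :
  pdist P Q ^ 2 = (fst P - fst Q) ^ 2 + (snd P - snd Q) ^ 2.
Proof.
  unfold pdist, dist_euc. rewrite pow2_sqrt.
  - unfold Rsqr; ring.
  - apply Rplus_le_le_0_compat; apply Rle_0_sqr.
Qed.

Lemma pdist_eq_0 (P Q : point) : pdist P Q = 0 -> P = Q.
Proof.
  intros h. pose proof (pdist_sqr P Q) as e. rewrite h in e.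
  destruct P as [x y], Q as [x' y']; simpl fst in e; simpl snd in e.
  destruct (Rplus_sqr_eq_0 (x - x') (y - y')); [unfold Rsqr; lra|].
  f_equal; lra.
Qed.

Lemma pdist_pos (P Q : point) : P <> Q -> 0 < pdist P Q.
Proof.
  intros h. destruct (pdist_nonneg P Q) as [|e]; [assumption|].
  exfalso; apply h, pdist_eq_0; congruence.
Qed.

Lemma area2_cycle (A B C : point) : area2 B C A = area2 A B C.
Proof. unfold area2; ring. Qed.

Lemma nondegenerate_side_pos (A B C : point) :
  nondegenerate A B C -> 0 < pdist A B.
Proof.
  intros h. apply pdist_pos. intros ->. apply h. unfold area2; ring.
Qed.

Lemma heron (A B C : point) :
  let a := pdist B C in let b := pdist C A in let c := pdist A B in
  4 * area2 A B C ^ 2 = (a + b + c) * (b + c - a) * (c + a - b) * (a + b - c).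
Proof.
  cbv zeta.
  (* The product is even in each side, so only squared distances occur and no square root
     survives. *)
  transitivity (2 * (pdist B C ^ 2 * pdist C A ^ 2 + pdist C A ^ 2 * pdist A B ^ 2
                     + pdist A B ^ 2 * pdist B C ^ 2)
    - (pdist B C ^ 2) ^ 2 - (pdist C A ^ 2) ^ 2 - (pdist A B ^ 2) ^ 2); [|ring].
  rewrite !pdist_sqr; unfold area2; ring.
Qed.

(** * The centers in terms of the vertices and the sides *)

Lemma circumcircle_sqr (A B C O : point) (Rc : R) :
  is_circumcircle A B C O Rc ->
  Rc ^ 2 = (fst O - fst A) ^ 2 + (snd O - snd A) ^ 2 /\
  Rc ^ 2 = (fst O - fst B) ^ 2 + (snd O - snd B) ^ 2 /\
  Rc ^ 2 = (fst O - fst C) ^ 2 + (snd O - snd C) ^ 2.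
Proof.
  intros [hA [hB hC]]. rewrite <- !pdist_sqr, hA, hB, hC. auto.
Qed.

Lemma sides_product (A B C O : point) (Rc : R) :
  is_circumcircle A B C O Rc ->
  pdist B C * pdist C A * pdist A B = 2 * Rc * Rabs (area2 A B C).
Proof.
  intros hO.
  destruct (circumcircle_sqr A B C O Rc hO) as [eA [eB eC]].
  destruct hO as [hA _].
  assert (hR : 0 <= Rc) by (rewrite <- hA; apply pdist_nonneg).
  apply Rsqr_inj.
  - repeat apply Rmult_le_pos; apply pdist_nonneg.
  - pose proof (Rabs_pos (area2 A B C)); nra.
  - rewrite !Rsqr_pow2.
    replace ((2 * Rc * Rabs (area2 A B C)) ^ 2)
      with (4 * Rc ^ 2 * (Rabs (area2 A B C)) ^ 2) by ring.
    rewrite pow2_abs.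
    replace ((pdist B C * pdist C A * pdist A B) ^ 2)
      with (pdist B C ^ 2 * pdist C A ^ 2 * pdist A B ^ 2) by ring.
    assert (h1 : pdist A B ^ 2 =
      2 * ((fst O - fst A) * (fst B - fst A) + (snd O - snd A) * (snd B - snd A)))
      by (rewrite pdist_sqr; lra).
    assert (h2 : pdist C A ^ 2 =
      2 * ((fst O - fst A) * (fst C - fst A) + (snd O - snd A) * (snd C - snd A)))
      by (rewrite pdist_sqr; lra).
    (* Cramer's rule for the equations of the perpendicular bisectors through O. *)
    assert (ex : 2 * (fst O - fst A) * area2 A B C =
      pdist A B ^ 2 * (snd C - snd A) - pdist C A ^ 2 * (snd B - snd A)).
    { rewrite h1, h2; unfold area2; ring. }
    assert (ey : 2 * (snd O - snd A) * area2 A B C =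
      pdist C A ^ 2 * (fst B - fst A) - pdist A B ^ 2 * (fst C - fst A)).
    { rewrite h1, h2; unfold area2; ring. }
    (* By the law of cosines at A, the squared length of b^2 (B - A) - c^2 (C - A) is a^2 b^2
       c^2. *)
    transitivity ((2 * (fst O - fst A) * area2 A B C) ^ 2
                  + (2 * (snd O - snd A) * area2 A B C) ^ 2).
    + rewrite ex, ey, !pdist_sqr. ring.
    + rewrite eA; ring.
Qed.

(** The barycentric coordinates u, v, w of I are ratios of signed areas. Being positive, they pass
    through the absolute values, so equal distances to the sides give u |D| = a r, v |D| = b r, w
    |D| = c r with D = [area2 A B C]. Summing yields |D| = (a + b + c) r, and r cancels. *)
Lemma incircle_barycentric (A B C I : point) (r : R) :
  nondegenerate A B C -> is_incircle A B C I r ->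
  let a := pdist B C in let b := pdist C A in let c := pdist A B in
  (a + b + c) * r = Rabs (area2 A B C) /\
  (a + b + c) * fst I = a * fst A + b * fst B + c * fst C /\
  (a + b + c) * snd I = a * snd A + b * snd B + c * snd C.
Proof.
  intros hABC [[u [v [w [hu [hv [hw [hs hI]]]]]]] [ha [hb hc]]]; cbv zeta.
  assert (pc := nondegenerate_side_pos A B C hABC).
  assert (pa : 0 < pdist B C).
  { apply (nondegenerate_side_pos B C A). unfold nondegenerate.
    now rewrite area2_cycle. }
  assert (pb : 0 < pdist C A).
  { apply (nondegenerate_side_pos C A B). unfold nondegenerate.
    now rewrite <- area2_cycle. }
  unfold nondegenerate in hABC.
  set (D := area2 A B C) in *.
  assert (pD : 0 < Rabs D) by now apply Rabs_pos_lt.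
  assert (ea : area2 B C I = u * D).
  { rewrite hI; unfold D, area2; simpl. replace u with (1 - v - w) by lra; ring. }
  assert (eb : area2 C A I = v * D).
  { rewrite hI; unfold D, area2; simpl. replace u with (1 - v - w) by lra; ring. }
  assert (ec : area2 A B I = w * D).
  { rewrite hI; unfold D, area2; simpl. replace u with (1 - v - w) by lra; ring. }
  unfold dist_line in *.
  rewrite ea, Rabs_mult, (Rabs_pos_eq u) in ha by lra.
  rewrite eb, Rabs_mult, (Rabs_pos_eq v) in hb by lra.
  rewrite ec, Rabs_mult, (Rabs_pos_eq w) in hc by lra.
  set (a := pdist B C) in *; set (b := pdist C A) in *; set (c := pdist A B) in *.
  assert (fa : u * Rabs D = a * r) by (rewrite <- ha; field; lra).
  assert (fb : v * Rabs D = b * r) by (rewrite <- hb; field; lra).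
  assert (fc : w * Rabs D = c * r) by (rewrite <- hc; field; lra).
  assert (er : (a + b + c) * r = Rabs D).
  { replace w with (1 - u - v) in fc by lra; lra. }
  assert (hr : r <> 0) by (intros ->; lra).
  rewrite <- er in fa, fb, fc.
  assert (ga : (a + b + c) * u = a) by (apply (Rmult_eq_reg_r r); [lra|assumption]).
  assert (gb : (a + b + c) * v = b) by (apply (Rmult_eq_reg_r r); [lra|assumption]).
  assert (gc : (a + b + c) * w = c) by (apply (Rmult_eq_reg_r r); [lra|assumption]).
  split; [exact er|].
  rewrite hI; simpl fst; simpl snd.
  split.
  - transitivity ((a + b + c) * u * fst A + (a + b + c) * v * fst B
                  + (a + b + c) * w * fst C); [ring|now rewrite ga, gb, gc].
  - transitivity ((a + b + c) * u * snd A + (a + b + c) * v * snd B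
                  + (a + b + c) * w * snd C); [ring|now rewrite ga, gb, gc].
Qed.

(** Since OA = OB = OC, the point A + B + C - 2 O satisfies the altitude equations. Its difference
    (x, y) from H is then orthogonal to the independent directions BC and CA, hence zero. *)
Lemma orthocenter_coord (A B C O H : point) (Rc : R) :
  nondegenerate A B C -> is_circumcircle A B C O Rc -> is_orthocenter A B C H ->
  fst H = fst A + fst B + fst C - 2 * fst O /\
  snd H = snd A + snd B + snd C - 2 * snd O.
Proof.
  intros hABC hO [h1 [h2 _]].
  destruct (circumcircle_sqr A B C O Rc hO) as [eA [eB eC]].
  unfold nondegenerate, area2, dot in *.
  set (x := fst H - (fst A + fst B + fst C - 2 * fst O)).
  set (y := snd H - (snd A + snd B + snd C - 2 * snd O)).
  assert (f1 : x * (fst C - fst B) + y * (snd C - snd B) = 0) by (unfold x, y; lra).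
  assert (f2 : x * (fst A - fst C) + y * (snd A - snd C) = 0) by (unfold x, y; lra).
  set (D := (fst B - fst A) * (snd C - snd A) - (snd B - snd A) * (fst C - fst A)) in *.
  assert (gx : x * D = 0).
  { transitivity ((x * (fst C - fst B) + y * (snd C - snd B)) * (snd A - snd C)
      - (x * (fst A - fst C) + y * (snd A - snd C)) * (snd C - snd B)).
    - unfold D; ring.
    - rewrite f1, f2; ring. }
  assert (gy : y * D = 0).
  { transitivity ((x * (fst A - fst C) + y * (snd A - snd C)) * (fst C - fst B)
      - (x * (fst C - fst B) + y * (snd C - snd B)) * (fst A - fst C)).
    - unfold D; ring.
    - rewrite f1, f2; ring. }
  apply Rmult_integral in gx, gy.
  destruct gx as [gx|]; [|contradiction]. destruct gy as [gy|]; [|contradiction].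
  unfold x, y in *; lra.
Qed.

Lemma dot_circumcenter (O A B : point) (Rc : R) :
  pdist O A = Rc -> pdist O B = Rc ->
  dot O A O B = Rc ^ 2 - pdist A B ^ 2 / 2.
Proof.
  intros hA hB.
  assert (eA := pdist_sqr O A). assert (eB := pdist_sqr O B).
  rewrite hA in eA; rewrite hB in eB.
  rewrite pdist_sqr; unfold dot; lra.
Qed.

Lemma OH_sides (A B C O H : point) (Rc : R) :
  nondegenerate A B C -> is_circumcircle A B C O Rc -> is_orthocenter A B C H ->
  pdist O H ^ 2 = 9 * Rc ^ 2 - (pdist B C ^ 2 + pdist C A ^ 2 + pdist A B ^ 2).
Proof.
  intros hABC hO hH.
  destruct (orthocenter_coord A B C O H Rc hABC hO hH) as [ex ey].
  destruct (circumcircle_sqr A B C O Rc hO) as [eA [eB eC]].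
  rewrite !pdist_sqr, ex, ey; lra.
Qed.

(** * Symmetric functions of the sides and mutual distances of O, H, I in s, r, [Rc] *)

Section Distances.

Variables (A B C I O H : point) (r Rc : R).
Hypotheses (hABC : nondegenerate A B C)
  (hI : is_incircle A B C I r)
  (hO : is_circumcircle A B C O Rc)
  (hH : is_orthocenter A B C H).

Let a := pdist B C.
Let b := pdist C A.
Let c := pdist A B.
Let s := semiperimeter A B C.

Lemma semiperimeter_pos : 0 < s.
Proof.
  assert (pc := nondegenerate_side_pos A B C hABC).
  pose proof (pdist_nonneg B C). pose proof (pdist_nonneg C A).
  unfold s, semiperimeter; lra.
Qed.

Lemma sides_sum : a + b + c = 2 * s.
Proof. unfold s, semiperimeter, a, b, c; lra. Qed.

Lemma sides_prod_srR : a * b * c = 4 * Rc * r * s.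
Proof.
  destruct (incircle_barycentric A B C I r hABC hI) as [er _].
  unfold a, b, c. rewrite (sides_product A B C O Rc hO), <- er.
  unfold s, semiperimeter; field.
Qed.

(** Heron's formula with doubled area 2 s r becomes s r^2 = (s - a)(s - b)(s - c). Expanding the
    right side leaves ab + bc + ca as the only unknown. *)
Lemma sides_pairs_srR : a * b + b * c + c * a = s ^ 2 + r ^ 2 + 4 * Rc * r.
Proof.
  assert (ps := semiperimeter_pos).
  destruct (incircle_barycentric A B C I r hABC hI) as [er _].
  fold a b c in er.
  assert (eh := heron A B C); cbv zeta in eh; fold a b c in eh.
  rewrite <- pow2_abs, <- er in eh.
  assert (es := sides_sum). assert (ep := sides_prod_srR).
  rewrite es in eh.
  replace (b + c - a) with (2 * (s - a)) in eh by lra.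
  replace (c + a - b) with (2 * (s - b)) in eh by lra.
  replace (a + b - c) with (2 * (s - c)) in eh by lra.
  (* The factor 16 s^2 makes the Heron product appear without division. *)
  apply (Rmult_eq_reg_l (16 * s * s)); [|nra].
  transitivity (2 * s * (2 * (s - a)) * (2 * (s - b)) * (2 * (s - c))
    + 16 * s * (a * b * c) + 16 * s ^ 3 * (a + b + c - s)).
  - ring.
  - rewrite <- eh, ep, es; ring.
Qed.

Lemma OH_srR : pdist O H ^ 2 = 9 * Rc ^ 2 + 8 * Rc * r + 2 * r ^ 2 - 2 * s ^ 2.
Proof.
  rewrite (OH_sides A B C O H Rc hABC hO hH). fold a b c.
  transitivity (9 * Rc ^ 2 - (a + b + c) ^ 2 + 2 * (a * b + b * c + c * a)).
  - ring.
  - rewrite sides_sum, sides_pairs_srR; ring.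
Qed.

Lemma incenter_rel :
  2 * s * (fst I - fst O) =
    a * (fst A - fst O) + b * (fst B - fst O) + c * (fst C - fst O) /\
  2 * s * (snd I - snd O) =
    a * (snd A - snd O) + b * (snd B - snd O) + c * (snd C - snd O).
Proof.
  destruct (incircle_barycentric A B C I r hABC hI) as [_ [ex ey]].
  fold a b c in ex, ey. rewrite <- sides_sum. lra.
Qed.

(** Euler's formula for the distance OI, obtained by squaring 2s OI = a OA + b OB + c OC. *)
Lemma OI_srR : pdist O I ^ 2 = Rc ^ 2 - 2 * Rc * r.
Proof.
  assert (ps := semiperimeter_pos).
  destruct incenter_rel as [ex ey].
  destruct (circumcircle_sqr A B C O Rc hO) as [eA [eB eC]].
  destruct hO as [hA [hB hC]].
  assert (dAB := dot_circumcenter O A B Rc hA hB).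
  assert (dBC := dot_circumcenter O B C Rc hB hC).
  assert (dCA := dot_circumcenter O C A Rc hC hA).
  fold a in dBC; fold b in dCA; fold c in dAB.
  apply (Rmult_eq_reg_l ((2 * s) ^ 2)); [|nra].
  rewrite pdist_sqr.
  transitivity ((2 * s * (fst I - fst O)) ^ 2 + (2 * s * (snd I - snd O)) ^ 2); [ring|].
  rewrite ex, ey.
  transitivity (a ^ 2 * Rc ^ 2 + b ^ 2 * Rc ^ 2 + c ^ 2 * Rc ^ 2
    + 2 * a * b * dot O A O B + 2 * b * c * dot O B O C + 2 * c * a * dot O C O A).
  (* Each rewrite consumes the first remaining [Rc ^ 2], so the three terms become a^2 OA^2, b^2
     OB^2, c^2 OC^2. *)
  - rewrite eA at 1. rewrite eB at 1. rewrite eC at 1. unfold dot; ring.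
  - rewrite dAB, dBC, dCA.
    transitivity ((a + b + c) ^ 2 * Rc ^ 2 - a * b * c * (a + b + c)); [field|].
    rewrite sides_prod_srR, sides_sum; ring.
Qed.

Lemma dot_OH_OI : dot O H O I = 3 * Rc ^ 2 + Rc * r - (s ^ 2 + r ^ 2) / 2.
Proof.
  assert (ps := semiperimeter_pos).
  destruct incenter_rel as [ex ey].
  destruct (orthocenter_coord A B C O H Rc hABC hO hH) as [fx fy].
  destruct (circumcircle_sqr A B C O Rc hO) as [eA [eB eC]].
  destruct hO as [hA [hB hC]].
  assert (dAB := dot_circumcenter O A B Rc hA hB).
  assert (dBC := dot_circumcenter O B C Rc hB hC).
  assert (dCA := dot_circumcenter O C A Rc hC hA).
  fold a in dBC; fold b in dCA; fold c in dAB.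
  apply (Rmult_eq_reg_l (2 * s)); [|lra].
  transitivity ((fst H - fst O) * (2 * s * (fst I - fst O))
    + (snd H - snd O) * (2 * s * (snd I - snd O))); [unfold dot; ring|].
  rewrite ex, ey, fx, fy.
  transitivity (a * Rc ^ 2 + b * Rc ^ 2 + c * Rc ^ 2
    + (a + b) * dot O A O B + (b + c) * dot O B O C + (c + a) * dot O C O A).
  - rewrite eA at 1. rewrite eB at 1. rewrite eC at 1. unfold dot; ring.
  - rewrite dAB, dBC, dCA.
    (* This uses (a + b) c^2 + (b + c) a^2 + (c + a) b^2 = (a + b + c)(ab + bc + ca) - 3abc. *)
    transitivity ((a + b + c) * (3 * Rc ^ 2 - (a * b + b * c + c * a) / 2)
                  + 3 / 2 * (a * b * c)); [field|].
    rewrite sides_prod_srR, sides_pairs_srR, sides_sum; field.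
Qed.

(** Law of cosines at O for the points H and I. *)
Lemma HI_srR : pdist H I ^ 2 = 4 * Rc ^ 2 + 4 * Rc * r + 3 * r ^ 2 - s ^ 2.
Proof.
  transitivity (pdist O H ^ 2 + pdist O I ^ 2 - 2 * dot O H O I).
  - rewrite !pdist_sqr; unfold dot; ring.
  - rewrite OH_srR, OI_srR, dot_OH_OI; field.
Qed.

(** * The equilateral case *)

Lemma OH_eq_0_equilateral : pdist O H ^ 2 = 0 -> equilateral A B C.
Proof.
  intros h.
  destruct (orthocenter_coord A B C O H Rc hABC hO hH) as [fx fy].
  destruct (circumcircle_sqr A B C O Rc hO) as [eA [eB eC]].
  assert (e : O = H) by (apply pdist_eq_0; nra). subst H.
  (* With H = O the vectors OA, OB, OC sum to zero. Having equal lengths, they also have equal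
     pairwise dot products, so the sides agree. *)
  assert (kx : fst C - fst O = - (fst A - fst O) - (fst B - fst O)) by lra.
  assert (ky : snd C - snd O = - (snd A - snd O) - (snd B - snd O)) by lra.
  split; apply Rsqr_inj; try apply pdist_nonneg; rewrite !Rsqr_pow2, !pdist_sqr.
  - replace (fst B - fst C) with ((fst B - fst O) - (fst C - fst O)) by ring.
    replace (snd B - snd C) with ((snd B - snd O) - (snd C - snd O)) by ring.
    replace (fst O - fst C) with (- (fst C - fst O)) in eC by ring.
    replace (snd O - snd C) with (- (snd C - snd O)) in eC by ring.
    rewrite kx, ky in *. lra.
  - replace (fst B - fst C) with ((fst B - fst O) - (fst C - fst O)) by ring.
    replace (snd B - snd C) with ((snd B - snd O) - (snd C - snd O)) by ring.
    replace (fst C - fst A) with ((fst C - fst O) - (fst A - fst O)) by ring.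
    replace (snd C - snd A) with ((snd C - snd O) - (snd A - snd O)) by ring.
    rewrite kx, ky in *. lra.
Qed.

(** Putting a = b = c in the side relations gives [Rc] = 2 r and s^2 = 27 r^2, for which the
    formulas for OH^2 and OI^2 vanish. *)
Lemma equilateral_centers : equilateral A B C -> H = O /\ O = I.
Proof.
  intros [e1 e2].
  assert (pc : 0 < c) by exact (nondegenerate_side_pos A B C hABC).
  fold a b c in e1, e2.
  assert (eb : b = c) by congruence. assert (ea : a = c) by congruence.
  assert (hsum := sides_sum). assert (hprod := sides_prod_srR).
  assert (hpairs := sides_pairs_srR).
  assert (hOH := OH_srR). assert (hOI := OI_srR).
  rewrite ea, eb in hsum, hprod, hpairs.
  assert (hs : s = 3 * c / 2) by lra.
  rewrite hs in hprod, hpairs, hOH.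
  assert (h6 : 6 * Rc * r = c ^ 2).
  { apply (Rmult_eq_reg_r c); lra. }
  assert (hr : 12 * r ^ 2 = c ^ 2) by lra.
  assert (hr0 : r <> 0) by (intros ->; nra).
  assert (hR : Rc = 2 * r) by (apply (Rmult_eq_reg_r r); lra).
  subst Rc.
  split.
  - symmetry; apply pdist_eq_0. nra.
  - apply pdist_eq_0. nra.
Qed.

End Distances.

(** * Minimizing the quadratic function of lambda *)

Lemma ELD_quadratic (I H O : point) (l : R) :
  ELD I H O l = pdist H I ^ 2
    - l * (pdist H I ^ 2 + pdist O H ^ 2 - pdist O I ^ 2) + l ^ 2 * pdist O H ^ 2.
Proof.
  (* The point is H + l (O - H); the linear coefficient is -2 (I - H).(O - H), rewritten by the law
     of cosines. *)
  unfold ELD, euler_point. rewrite !pdist_sqr; simpl fst; simpl snd; ring.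
Qed.

(** An attained lower bound is the greatest one, and it is finite, so [real] returns it
    unchanged. *)
Lemma min_ELD_attained (I H O : point) (l0 : R) :
  (forall l, ELD I H O l0 <= ELD I H O l) -> min_ELD I H O = ELD I H O l0.
Proof.
  intros h. unfold min_ELD.
  rewrite (is_glb_Rbar_unique _ (Finite (ELD I H O l0))); [reflexivity|].
  split.
  - intros y [l ->]. apply h.
  - intros m hm. apply hm. now exists l0.
Qed.

(** Completing the square: K is the leading coefficient and M / (2 K) the vertex. *)
Lemma ELD_vertex (I H O : point) (l : R) :
  pdist O H ^ 2 <> 0 ->
  let K := pdist O H ^ 2 in
  let M := pdist H I ^ 2 + pdist O H ^ 2 - pdist O I ^ 2 in
  ELD I H O l = (4 * pdist H I ^ 2 * K - M ^ 2) / (4 * K) + K * (l - M / (2 * K)) ^ 2.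
Proof.
  cbv zeta. rewrite ELD_quadratic.
  generalize (pdist O H ^ 2) (pdist H I ^ 2) (pdist O I ^ 2).
  intros K x y hK. field. exact hK.
Qed.

Lemma ELD_minimizer (I H O : point) :
  pdist O H ^ 2 <> 0 ->
  let K := pdist O H ^ 2 in
  let M := pdist H I ^ 2 + pdist O H ^ 2 - pdist O I ^ 2 in
  ELD I H O (M / (2 * K)) = (4 * pdist H I ^ 2 * K - M ^ 2) / (4 * K) /\
  (forall l, ELD I H O (M / (2 * K)) <= ELD I H O l).
Proof.
  intros h K M.
  assert (e : ELD I H O (M / (2 * K)) = (4 * pdist H I ^ 2 * K - M ^ 2) / (4 * K)).
  { rewrite (ELD_vertex I H O _ h). cbv zeta; fold M; fold K; ring. }
  split; [exact e|].
  intros l. rewrite e, (ELD_vertex I H O l h). cbv zeta; fold M; fold K.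
  assert (0 <= K * (l - M / (2 * K)) ^ 2) by (apply Rmult_le_pos; apply pow2_ge_0).
  lra.
Qed.

Theorem theorem2 (A B C I O H : point) (r Rc : R)
  (hABC : nondegenerate A B C)
  (hI : is_incircle A B C I r)
  (hO : is_circumcircle A B C O Rc)
  (hH : is_orthocenter A B C H) :
  let s := semiperimeter A B C in
  let dI := min_ELD I H O in
  (forall lambda : R, ELD I H O lambda >= dI /\ dI >= 0) /\
  (exists lambda : R, ELD I H O lambda = dI) /\
  (~ equilateral A B C ->
     pdist O H ^ 2 = 9 * Rc ^ 2 + 8 * Rc * r + 2 * r ^ 2 - 2 * s ^ 2 /\
     pdist O H ^ 2 <> 0 /\
     dI = - (s ^ 4 - 2 * (2 * Rc ^ 2 + 10 * Rc * r - r ^ 2) * s ^ 2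
             + r * (4 * Rc + r) ^ 3)
          / (4 * (9 * Rc ^ 2 + 8 * Rc * r + 2 * r ^ 2 - 2 * s ^ 2))) /\
  (equilateral A B C -> H = O /\ O = I /\ dI = 0).
Proof.
  intros s dI.
  assert (attained : exists l0, dI = ELD I H O l0 /\
                       forall l, ELD I H O l0 <= ELD I H O l).
  { destruct (Req_dec (pdist O H ^ 2) 0) as [h|h].
    (* When O = H the function is constant, so any parameter is a minimizer; 0 is taken. *)
    - assert (e : O = H).
      { apply pdist_eq_0. nra. }
      assert (k : forall l, ELD I H O 0 <= ELD I H O l).
      { intros l. rewrite !ELD_quadratic, h. subst H. lra. }
      exists 0; split; [now apply min_ELD_attained|exact k].
    - destruct (ELD_minimizer I H O h) as [_ m].
      eexists; split; [now apply min_ELD_attained|exact m]. }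
  destruct attained as [l0 [e0 m0]].
  split; [|split; [|split]].
  - intros l. rewrite e0. split; apply Rle_ge; [apply m0|apply pow2_ge_0].
  - now exists l0.
  - intros ne.
    assert (eOH : pdist O H ^ 2 = _) by exact (OH_srR A B C I O H r Rc hABC hI hO hH).
    fold s in eOH.
    assert (h : pdist O H ^ 2 <> 0).
    { intros h. apply ne. exact (OH_eq_0_equilateral A B C O H Rc hABC hO hH h). }
    split; [exact eOH|split; [exact h|]].
    destruct (ELD_minimizer I H O h) as [e m].
    unfold dI. rewrite (min_ELD_attained I H O _ m), e.
    (* Here M = 12 [Rc]^2 + 14 [Rc] r + 5 r^2 - 3 s^2, and 4 HI^2 OH^2 - M^2 is minus the stated
       quartic in s. *)
    rewrite (HI_srR A B C I O H r Rc hABC hI hO hH), (OI_srR A B C I O r Rc hABC hI hO).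
    fold s. rewrite eOH in *. field. exact h.
  - intros heq.
    destruct (equilateral_centers A B C I O H r Rc hABC hI hO hH heq) as [e1 e2].
    split; [exact e1|split; [exact e2|]].
    (* All three centers coincide, so the Euler point is I for every parameter. *)
    rewrite e0. subst H I. unfold ELD, euler_point.
    rewrite pdist_sqr; simpl fst; simpl snd; ring.
Qed.
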